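(* Let $(T_n)_{n\ge 1}$ be a uniform random recursive tree and let $R_n$ be the betweenness rank of the root (vertex $1$) in $T_n$. Then $$\liminf_{n\to\infty}\mathbb{P}(R_n=1)\ge 3-\sqrt5-\log 2\approx 0.070784,$$ where $\log$ is the natural logarithm.
   Context: A uniform random recursive tree (URRT) is a random sequence of trees $(T_n)_{n\ge 1}$ with $V(T_n)=[n]=\{1,\ldots,n\}$: $T_1$ is the single vertex $1$ (the root), and $T_{n+1}$ is obtained from $T_n$ by adding vertex $n+1$ and an edge $\{i,n+1\}$, where $i$ is chosen uniformly at random from $[n]$, independently of the past. The betweenness centrality of $v\in V(T_n)$ is $\mathcal{B}_{T_n}(v)=\sum_{s,t\in V(T_n):\,s,t\ne v}\mathbf{1}_{\{v\in\sigma_{s,t}\}}$, where $\sigma_{s,t}$ is the path between $s$ and $t$ in $T_n$ excluding $s$ and $t$; larger values correspond to more central vertices. Ranking: vertices are ordered from most to least central; vertices with equal centrality value are ordered in reverse order of insertion time (if $u,v$ have equal centrality, $u$ is ranked before $v$ iff $u>v$). This gives a permutation $\gamma_n$ of $[n]$, where $\gamma_n(v)\in\{1,\ldots,n\}$ is the position of $v$ in this order (position $1$ being most central). The rank of the root is $R_n=\gamma_n(1)$. *)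

(* Defs.v *)
From HB Require Import structures.
From mathcomp Require Import all_boot all_order all_algebra finmap.
From mathcomp Require Import all_classical all_reals all_analysis.

Set Implicit Arguments.
Unset Strict Implicit.
Unset Printing Implicit Defensive.

Import Order.TTheory GRing.Theory Num.Theory.

Local Open Scope classical_set_scope.

(* An edge {u, v} is the finite set [fset u; v], so edges are undirected. *)
Record graph := Graph {
  vertices : {fset nat};
  edges : {fset {fset nat}} }.

Definition adj (G : graph) : rel nat :=
  fun u v => [fset u; v]%fset \in edges G.

Definition simple_path (G : graph) (s t : nat) (p : seq nat) : Prop :=
  [/\ path (adj G) s p, uniq (s :: p) & last s p = t].

(* The vertices of the path from s to t, without s. If G is a tree and s, t are
   vertices of G, there is exactly one such path and xget returns it. *)
Definition tree_path (G : graph) (s t : nat) : seq nat :=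
  xget [::] [set p | simple_path G s t p].

(* belast removes t from s :: tree_path G s t, and behead removes s; the result
   is empty when s = t. *)
Definition path_interior (G : graph) (s t : nat) : seq nat :=
  behead (belast s (tree_path G s t)).

(* The sum is over ordered pairs (s, t). *)
Definition betweenness (G : graph) (v : nat) : nat :=
  \sum_(s <- vertices G | s != v) \sum_(t <- vertices G | t != v)
    (v \in path_interior G s t : nat).

(* Reflexive version of the ranking order: u precedes v if u is more central,
   or if u and v are equally central and u was inserted later. *)
Definition ranked_before (G : graph) : rel nat := fun u v =>
  (betweenness G v < betweenness G u)%N
  || (betweenness G u == betweenness G v) && (v <= u)%N.

Definition betweenness_rank (G : graph) (v : nat) : nat :=
  (index v (sort (ranked_before G) (vertices G))).+1.

Definition root_graph : graph := Graph [fset 1%N]%fset fset0.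

Definition attach (G : graph) (i v : nat) : graph :=
  Graph (v |` vertices G)%fset ([fset i; v] |` edges G)%fset.

Local Open Scope ring_scope.

(* T 0 plays no role. The events called past form a pi-system that generates the
   sigma-algebra of T 1, ..., T n, so the last clause says that U n is
   independent of (T 1, ..., T n). *)
Definition is_urrt (R : realType) (d : measure_display)
    (Omega : measurableType d) (P : probability Omega R)
    (T : nat -> Omega -> graph) : Prop :=
  (forall (n : nat) (A : set graph), (0 < n)%N -> measurable (T n @^-1` A)) /\
  (forall w, T 1%N w = root_graph) /\
  exists U : nat -> Omega -> nat, forall n : nat, (0 < n)%N ->
    [/\ forall B : set nat, measurable (U n @^-1` B),
        forall w, (1 <= U n w <= n)%N /\ T n.+1 w = attach (T n w) (U n w) n.+1,
        forall i : nat, (1 <= i <= n)%N ->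
          P (U n @^-1` [set i]) = (n%:R^-1)%:E
      & forall (B : set nat) (A : nat -> set graph),
          let past := \bigcap_(m in [set m | (1 <= m <= n)%N]) (T m @^-1` A m) in
          P (U n @^-1` B `&` past) = (P (U n @^-1` B) * P past)%E].

(* Main.v *)
(* The branches of the root (its subtrees with the root removed) grow as a
   Chinese restaurant process. Let c = (3 - sqrt 5) / 2, the smaller root of
   c^2 - 3 c + 1. If v lies in a branch of x <= L <= c n vertices, then two
   vertices outside that branch are never separated by v, so that
   B(v) <= (n-1)^2 - (n-x)^2, while B(1) >= (n-1-x) (n-1+x-L); the choice of c
   makes B(1) larger. So the root is ranked first unless the largest branch
   exceeds c n.

   With m = n - 1, the number of branches of size k has mean 1/k, and the number
   of ordered pairs of distinct branches of sizes k and j has mean 1/(k j) if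
   k + j <= m. When 3 k > m, at most one branch is larger than a given branch of
   size k, so the largest branch has size k with probability at most
   1/k (1 - sum_(k < j <= m - k) 1/j). This is 1/k for k > m/2, which sums to
   log 2, and at most 1/(m - k) <= 2/m for c n < k <= m/2, which sums to
   1 - 2 c = sqrt 5 - 2. *)
Require Import Defs.
From mathcomp Require Import all_boot all_order all_algebra finmap zify ring
  lra.
From mathcomp Require Import all_classical all_reals all_analysis.

Set Implicit Arguments.
Unset Strict Implicit.
Unset Printing Implicit Defensive.

Import Order.TTheory GRing.Theory Num.Theory.

Local Arguments iota : simpl never.

(** * Branch sizes *)

(* The head of a parent sequence is the parent of the vertex inserted last, that
   is, of vertex m + 1; vertices are numbered from 1. *)
Fixpoint parent_seqs (m : nat) : seq (seq nat) :=
  if m is m'.+1 then [seq i :: p | i <- iota 1 m, p <- parent_seqs m']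
  else [:: [::]].

Fixpoint rec_tree (p : seq nat) : graph :=
  if p is i :: p' then attach (rec_tree p') i (size p').+2 else root_graph.

(** A branch is labelled by its smallest vertex, which is a child of the root. The root has label 1,
    so labels of branches start at 2. *)
Fixpoint branch (p : seq nat) (x : nat) : nat :=
  if p is i :: p' then
    if x == (size p').+2 then (if i == 1 then x else branch p' i)
    else branch p' x
  else x.

Definition branch_size (p : seq nat) (a : nat) : nat :=
  count (fun x => branch p x == a) (iota 1 (size p).+1).

Lemma parent_seqs_rec m : parent_seqs m.+1 =
  [seq i :: p | i <- iota 1 m.+1, p <- parent_seqs m].
Proof. by []. Qed.

Lemma parent_seqsS m p : p \in parent_seqs m.+1 ->
  exists i p', [/\ p = i :: p', 1 <= i <= m.+1 & p' \in parent_seqs m].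
Proof.
case/allpairsP => -[i p'] [hi hp ->]; exists i, p'; split=> //.
by move: hi; rewrite mem_iota [(i, p').1]/=; lia.
Qed.

Lemma size_parent_seqs m p : p \in parent_seqs m -> size p = m.
Proof.
elim: m p => [|m IH] p; first by rewrite inE => /eqP ->.
by case/parent_seqsS => i [p' [-> _ /IH /= ->]].
Qed.

Lemma branch_root p : branch p 1 = 1.
Proof. by elim: p. Qed.

Lemma branch_bounds m p x : p \in parent_seqs m -> 1 < x <= m.+1 ->
  1 < branch p x <= x.
Proof.
elim: m p x => [|m IH] p x; first by lia.
case/parent_seqsS => i [p' [-> hi hp]] /= hx.
rewrite (size_parent_seqs hp); case: eqP => xE; last by apply: IH => //; lia.
by case: eqP => [|i1]; [lia | have := IH _ i hp; lia].
Qed.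

Lemma branch_size_rcons i p a :
  branch_size (i :: p) a =
  count (fun x => branch (i :: p) x == a) (iota 1 (size p).+1) +
  ((if i == 1 then (size p).+2 else branch p i) == a).
Proof.
rewrite /branch_size [size (i :: p)]/=.
have -> : iota 1 (size p).+2 = iota 1 (size p).+1 ++ [:: (size p).+2].
  by rewrite -[(size p).+2 in LHS]addn1 iotaD.
by rewrite count_cat; congr (_ + _)%N; rewrite /= eqxx addn0.
Qed.

(** A child of the root gets the fresh label [m.+2]; any other new vertex joins the branch of its
    parent. For [i = 1] both sides agree because the root has label 1, not [a]. *)
Lemma branch_size_cons m i p a : p \in parent_seqs m -> 1 <= i <= m.+1 ->
  1 < a <= m.+1 ->
  branch_size (i :: p) a = (branch p i == a) + branch_size p a.
Proof.
move=> hp hi ha; rewrite branch_size_rcons addnC (size_parent_seqs hp).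
congr (_ + _)%N.
  case: (eqVneq i 1) => [->|//]; rewrite branch_root; lia.
rewrite /branch_size (size_parent_seqs hp); apply: eq_in_count => x.
rewrite mem_iota [branch (_ :: _) _]/= (size_parent_seqs hp) => hx.
by case: (eqVneq x m.+2); lia.
Qed.

Lemma branch_size_new m i p : p \in parent_seqs m -> 1 <= i <= m.+1 ->
  branch_size (i :: p) m.+2 = (i == 1).
Proof.
move=> hp hi; rewrite branch_size_rcons (size_parent_seqs hp).
rewrite (_ : count _ _ = 0); last first.
  apply/eqP; rewrite -leqn0 leqNgt -has_count; apply/hasPn => x.
  rewrite mem_iota [branch (_ :: _) _]/= (size_parent_seqs hp) => hx.
  case: (eqVneq x m.+2) => [|_]; first lia.
  case: (eqVneq x 1) => [->|x1]; first by rewrite branch_root.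
  by have := branch_bounds (x := x) hp; lia.
case: (eqVneq i 1) => [_|i1]; first by rewrite eqxx.
by have := branch_bounds (x := i) hp; lia.
Qed.

(** * Branch counts summed over all recursive trees *)

Lemma size_parent_seqs_fact m : size (parent_seqs m) = m`!.
Proof.
by elim: m => // m IH; rewrite parent_seqs_rec size_allpairs size_iota IH factS.
Qed.

Lemma sum_parent_seqsS m (f : seq nat -> nat) :
  \sum_(p <- parent_seqs m.+1) f p =
  \sum_(p <- parent_seqs m) \sum_(i <- iota 1 m.+1) f (i :: p).
Proof. by rewrite parent_seqs_rec big_allpairs_dep exchange_big. Qed.

Lemma sum_branch1 m p a (F : bool -> nat) : p \in parent_seqs m ->
  \sum_(i <- iota 1 m.+1) F (branch p i == a) =
  branch_size p a * F true + (m.+1 - branch_size p a) * F false.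
Proof.
move=> hp; rewrite /branch_size (size_parent_seqs hp).
set s := iota _ _; have -> : m.+1 = size s by rewrite size_iota.
elim: s => [|x s IH]; first by rewrite big_nil.
have := count_size (fun x => branch p x == a) s.
by rewrite big_cons IH /=; case: eqP => /=; nia.
Qed.

Lemma sum_branch2 m p a b (F : bool -> bool -> nat) : p \in parent_seqs m ->
  a != b ->
  \sum_(i <- iota 1 m.+1) F (branch p i == a) (branch p i == b) =
  branch_size p a * F true false + branch_size p b * F false true
  + (m.+1 - branch_size p a - branch_size p b) * F false false.
Proof.
move=> hp ab; rewrite /branch_size (size_parent_seqs hp).
set s := iota _ _; have -> : m.+1 = size s by rewrite size_iota.
have : count (fun x => branch p x == a) s +
       count (fun x => branch p x == b) s <= size s /\
  \sum_(i <- s) F (branch p i == a) (branch p i == b) =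
  count (fun x => branch p x == a) s * F true false +
  count (fun x => branch p x == b) s * F false true +
  (size s - count (fun x => branch p x == a) s -
   count (fun x => branch p x == b) s) * F false false; last by case.
elim: s => [|x s [IH1 IH2]]; first by rewrite big_nil.
rewrite big_cons IH2 /=; case: (eqVneq (branch p x) a) => [->|_].
  by rewrite (negbTE ab) /=; split; nia.
by case: eqP => /=; split; nia.
Qed.

(** Labels that are not children of the root have size 0, so for [k > 0] only genuine branches are
    counted. *)
Definition nbranches p k : nat :=
  \sum_(2 <= a < (size p).+2) (branch_size p a == k).

Definition nbranch_pairs p k j : nat :=
  \sum_(2 <= a < (size p).+2) \sum_(2 <= b < (size p).+2 | a != b)
     ((branch_size p a == k) && (branch_size p b == j)).

Lemma sum_nbranches_step m p k : p \in parent_seqs m -> 0 < k ->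
  \sum_(i <- iota 1 m.+1) nbranches (i :: p) k =
  (m.+1 - k) * nbranches p k + k.-1 * nbranches p k.-1 + (k == 1).
Proof.
move=> hp k0; rewrite /nbranches /= (size_parent_seqs hp).
under eq_bigr do rewrite big_nat_recr //=.
rewrite big_split /=; congr (_ + _)%N.
  rewrite exchange_big !big_distrr -big_split; apply: eq_big_nat => a ha /=.
  transitivity (\sum_(i <- iota 1 m.+1)
     (((branch p i == a) + branch_size p a)%N == k : nat)).
    apply: eq_big_seq => i; rewrite mem_iota => hi.
    by rewrite (branch_size_cons hp) //; lia.
  rewrite (sum_branch1 a (fun c => (c + branch_size p a)%N == k : nat) hp) /=.
  rewrite add1n; case: (eqVneq (branch_size p a).+1 k) => [<-|] /=;
    case: eqVneq => //=; nia.
rewrite (eq_big_seq (fun i => (i == 1) && (k == 1) : nat)); last first.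
  move=> i; rewrite mem_iota => hi; rewrite (branch_size_new hp) //.
  by case: (i == 1) => //=; lia.
rewrite big_cons eqxx /= big1_seq ?addn0 // => i /=.
by rewrite mem_iota; lia.
Qed.

(** The mean 1/k solves the one-step recurrence, since (m + 1 - k)/k + 1 = (m + 1)/k. *)
Lemma sum_nbranches m k : 0 < k <= m ->
  k * \sum_(p <- parent_seqs m) nbranches p k = m`!.
Proof.
elim: m k => [|m IH] k hk; first lia.
have k0 : 0 < k by lia.
rewrite sum_parent_seqsS.
rewrite (eq_big_seq _ (fun p hp => sum_nbranches_step hp k0)).
rewrite !big_split -!big_distrr /= big_const_seq
  count_predT iter_addn_0 size_parent_seqs_fact factS.
set A := \sum_(_ <- _) nbranches _ k; set B := \sum_(_ <- _) nbranches _ k.-1.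
have hA : k <= m -> k * A = m`! by move=> km; apply: IH; lia.
have hB : 1 < k -> k.-1 * B = m`! by move=> km; apply: IH; lia.
(* For [k = m.+1] the induction hypothesis does not apply, but the coefficient vanishes. *)
have hA' : (m.+1 - k) * (k * A) = (m.+1 - k) * m`!.
  by case: (leqP k m) => [/hA -> //|km]; rewrite (_ : m.+1 - k = 0); lia.
case: (eqVneq k 1) => [k1|k1] /=; first by subst k; nia.
have hB' := hB ltac:(lia); nia.
Qed.

Lemma sum_nbranch_pairs_step m p k j : p \in parent_seqs m -> 0 < k -> 0 < j ->
  \sum_(i <- iota 1 m.+1) nbranch_pairs (i :: p) k j =
  (m.+1 - k - j) * nbranch_pairs p k j + k.-1 * nbranch_pairs p k.-1 j
  + j.-1 * nbranch_pairs p k j.-1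
  + (j == 1) * nbranches p k + (k == 1) * nbranches p j.
Proof.
move=> hp k0 j0; rewrite /nbranch_pairs /nbranches /= (size_parent_seqs hp).
(* The three sums collect the pairs of two old labels, those whose second label is fresh, and those
   whose first label is fresh. *)
transitivity (\sum_(i <- iota 1 m.+1)
  (\sum_(2 <= a < m.+2) \sum_(2 <= b < m.+2 | a != b)
     (((branch p i == a) + branch_size p a == k) &&
      ((branch p i == b) + branch_size p b == j)) +
   \sum_(2 <= a < m.+2) (((branch p i == a) + branch_size p a == k) &&
      ((i == 1 : nat) == j)) +
   \sum_(2 <= b < m.+2) (((i == 1 : nat) == k) &&
     ((branch p i == b) + branch_size p b == j)))).
  apply: eq_big_seq => i; rewrite mem_iota => hi.
  rewrite big_nat_recr //= -big_split /=; congr (_ + _)%N.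
    apply: eq_big_nat => a ha.
    rewrite big_mkcond big_nat_recr //= -big_mkcond.
    rewrite (_ : a != m.+2); last lia.
    rewrite (branch_size_new hp) // (branch_size_cons hp) //; congr (_ + _)%N.
    rewrite [LHS]big_nat_cond [RHS]big_nat_cond.
    by apply: eq_bigr => b hb; rewrite (branch_size_cons hp) //; lia.
  rewrite big_mkcond big_nat_recr //= eqxx addn0 -big_mkcond.
  rewrite [LHS]big_nat_cond [RHS]big_nat_cond; apply: eq_big => b; first lia.
  move=> hb; rewrite (branch_size_new hp) // (branch_size_cons hp) //; lia.
rewrite !big_split /=.
(* The fresh label has positive size only for [i = 1], and then no old branch grows. *)
have new (F : nat -> nat -> bool) l : 0 < l ->
  \sum_(i <- iota 1 m.+1) \sum_(2 <= a < m.+2)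
    (F (branch p i) a && ((i == 1 : nat) == l)) =
  (l == 1) * \sum_(2 <= a < m.+2) F 1 a.
  move=> l0; rewrite -[iota _ _]/(1 :: iota 2 m) big_cons eqxx [X in _ +
    X]big1_seq.
    rewrite addn0 branch_root big_distrr /=; apply: eq_bigr => a _.
    by rewrite eq_sym; case: (l == 1); rewrite ?andbT ?andbF ?mul1n.
  move=> i /=; rewrite mem_iota => hi; rewrite big1 // => a _; lia.
congr (_ + _ + _)%N.
- rewrite exchange_big !big_distrr -!big_split; apply: eq_big_nat => a ha /=.
  rewrite exchange_big !big_distrr -!big_split; apply: eq_bigr => b hb /=.
  rewrite (sum_branch2 (fun c d => ((c + branch_size p a)%N == k) &&
     ((d + branch_size p b)%N == j) : nat) hp hb) /= !add0n !add1n.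
  move: (branch_size p a) (branch_size p b) => x y.
  rewrite -(prednK k0) -(prednK j0) !eqSS /=.
  move: (k.-1) (j.-1) => k1 j1.
  case: (eqVneq x k1) => ?; case: (eqVneq y j1) => ?;
  case: (eqVneq x k1.+1) => ?; case: (eqVneq y j1.+1) => ? /=; subst; nia.
- rewrite (new (fun x a => (x == a) + branch_size p a == k)) //; congr muln.
  apply: eq_big_nat => a ha; rewrite (_ : 1 == a = false) //; lia.
- transitivity (\sum_(i <- iota 1 m.+1) \sum_(2 <= b < m.+2)
    (((branch p i == b) + branch_size p b == j) && ((i == 1 : nat) == k))).
    by apply: eq_bigr => i _; apply: eq_bigr => b _; rewrite andbC.
  rewrite (new (fun x a => (x == a) + branch_size p a == j)) //; congr muln.
  apply: eq_big_nat => a ha; rewrite (_ : 1 == a = false) //; lia.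
Qed.
(** The mean 1/(k j) solves the recurrence, since (m + 1 - k - j) + k + j = m + 1. If [k] or [j] is
    1, the mean number of single branches supplies the missing term. *)
Lemma sum_nbranch_pairs m k j : 0 < k -> 0 < j -> k + j <= m ->
  k * j * \sum_(p <- parent_seqs m) nbranch_pairs p k j = m`!.
Proof.
elim: m k j => [|m IH] k j k0 j0 kjm; first lia.
rewrite sum_parent_seqsS.
rewrite (eq_big_seq _ (fun p hp => sum_nbranch_pairs_step hp k0 j0)).
rewrite !big_split -!big_distrr /= factS.
have hNk : k * \sum_(p <- parent_seqs m) nbranches p k = m`!.
  by apply: sum_nbranches; lia.
have hNj : j * \sum_(p <- parent_seqs m) nbranches p j = m`!.
  by apply: sum_nbranches; lia.
have := IH k j k0 j0; have := IH k.-1 j; have := IH k j.-1.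
move: (\sum_(_ <- _) _) hNk (\sum_(_ <- _) _) hNj (\sum_(_ <- _) _)
  (\sum_(_ <- _) _) (\sum_(_ <- _) _) => Nk hNk Nj hNj A B C hC hB hA.
have eA : (m.+1 - k - j) * (k * j * A) = (m.+1 - k - j) * m`!.
  by case: (leqP (k + j) m) => [/hA -> //|?]; rewrite (_ : m.+1 - k - j = 0);
    lia.
have eB : k * j * (k.-1 * B + (k == 1) * Nj) = k * m`!.
  case: (eqVneq k 1) => [k1|k1] /=; first by subst k; nia.
  by rewrite addn0 -(hB ltac:(lia) j0 ltac:(lia)) -!mulnA [j * _]mulnCA.
have eC : k * j * (j.-1 * C + (j == 1) * Nk) = j * m`!.
  case: (eqVneq j 1) => [j1|j1] /=; first by subst j; nia.
  by rewrite addn0 -(hC k0 ltac:(lia) ltac:(lia)) -!mulnA [k * _]mulnCA.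
rewrite (_ : _ * _ * _ = (m.+1 - k - j) * (k * j * A) +
  k * j * (k.-1 * B + (k == 1) * Nj) + k * j * (j.-1 * C + (j == 1) * Nk));
  last lia.
by rewrite eA eB eC -!mulnDl; congr muln; lia.
Qed.

(** * Large branches in a fixed tree *)

Lemma sum_nat_indicator (I : eqType) (s : seq I) (P : pred I) :
  \sum_(x <- s) (P x : nat) = count P s.
Proof. by rewrite -sum1_count [RHS]big_mkcond. Qed.

Lemma sum_branch_size m p : p \in parent_seqs m ->
  \sum_(2 <= a < m.+2) branch_size p a = m.
Proof.
move=> hp; rewrite /branch_size (size_parent_seqs hp).
under eq_bigr do rewrite -sum_nat_indicator.
rewrite exchange_big /= -[iota _ _]/(1 :: iota 2 m) big_cons.
rewrite [X in X + _]big1_seq ?add0n; last first.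
  by move=> a /=; rewrite branch_root mem_index_iota; lia.
rewrite (eq_big_seq (fun=> 1)); first by rewrite sum1_size size_iota.
move=> x; rewrite mem_iota => hx; rewrite sum_nat_indicator.
rewrite (eq_count (a2 := pred1 (branch p x))); last by move=> a;
  rewrite /= eq_sym.
rewrite count_uniq_mem ?iota_uniq // mem_index_iota.
by have := branch_bounds (x := x) hp; lia.
Qed.

(** Outside a branch of size [k] there are m - k < 2 (k + 1) non-root vertices, which leaves room
    for at most one larger branch. *)
Lemma sum_nbranch_pairs_le m p k : p \in parent_seqs m -> m < 3 * k + 2 ->
  \sum_(k.+1 <= j < (m - k).+1) nbranch_pairs p k j <= nbranches p k.
Proof.
move=> hp hk; rewrite /nbranch_pairs /nbranches (size_parent_seqs hp).
rewrite exchange_big big_seq [leqRHS]big_seq /=; apply: leq_sum => a.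
rewrite mem_index_iota => ha.
rewrite exchange_big /=.
case: (eqVneq (branch_size p a) k) => [ak|_]; last by rewrite big1 // => b _;
  rewrite big1.
have := sum_branch_size hp;
  rewrite (bigD1_seq a) ?iota_uniq ?mem_index_iota //=.
rewrite ak => hm.
have : k.+1 * \sum_(2 <= b < m.+2 | a != b) \sum_(k.+1 <= j < (m - k).+1)
    (branch_size p b == j : nat) <=
    \sum_(2 <= b < m.+2 | b != a) branch_size p b.
  rewrite big_distrr /= (eq_bigl (fun b => b != a)); last by move=> b;
    rewrite eq_sym.
  apply: leq_sum => b _; rewrite sum_nat_indicator.
  rewrite (eq_count (a2 := pred1 (branch_size p b))); last by move=> j;
    rewrite /= eq_sym.
  by rewrite count_uniq_mem ?iota_uniq // mem_index_iota; lia.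
set s := \sum_(_ <= _ < _ | a != _) _; move=> hs; change (s <= 1); nia.
Qed.

(* Read as an upper bound for [has _ _]: a branch larger than [L] is counted by
   the term [k] equal to the maximal branch size, whose pair terms vanish. *)
Lemma has_large_branch_le m p L : p \in parent_seqs m -> m <= 3 * L.+1 ->
  has (fun a => L < branch_size p a) (iota 2 m) +
  \sum_(L.+1 <= k < m.+1) \sum_(k.+1 <= j < (m - k).+1) nbranch_pairs p k j
  <= \sum_(L.+1 <= k < m.+1) nbranches p k.
Proof.
move=> hp hL.
have le k : k \in index_iota L.+1 m.+1 ->
    \sum_(k.+1 <= j < (m - k).+1) nbranch_pairs p k j <= nbranches p k.
  by rewrite mem_index_iota => hk; apply: sum_nbranch_pairs_le => //; lia.
case: hasP => [[a ha aL]|_]; last first.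
  by rewrite add0n big_seq [leqRHS]big_seq; apply: leq_sum => k /le.
have cm b : b \in iota 2 m -> branch_size p b <= m.
  move=> hb; rewrite -[leqRHS](sum_branch_size hp).
  by rewrite (bigD1_seq b) ?iota_uniq ?leq_addr //; move: hb;
    rewrite mem_iota mem_index_iota; lia.
have ex : exists k, has (fun b => branch_size p b == k) (iota 2 m).
  by exists (branch_size p a); apply/hasP; exists a.
have bd k : has (fun b => branch_size p b == k) (iota 2 m) -> k <= m.
  by case/hasP => b /cm + /eqP <-.
(* [K] is the largest branch size. *)
case: (ex_maxnP ex bd) => K /hasP[b hb /eqP bK] Kmax.
have KL : L < K by apply: (leq_trans aL); apply: Kmax; apply/hasP; exists a.
have Km : K <= m by rewrite -bK cm.
have Kin : K \in index_iota L.+1 m.+1 by rewrite mem_index_iota; lia.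
rewrite (bigD1_seq K) ?iota_uniq //= [leqRHS](bigD1_seq K) ?iota_uniq //=.
rewrite addnA; apply: leq_add; last first.
  by rewrite big_seq_cond [leqRHS]big_seq_cond; apply: leq_sum => k /andP[/le].
(* No branch is larger than [K], so the pair terms for [K] vanish and the branch [b] pays for the
   indicator. *)
rewrite big1_seq; last first.
  move=> j /=; rewrite mem_index_iota => hj.
  rewrite /nbranch_pairs (size_parent_seqs hp) big1 // => c _.
  rewrite big1_seq // => d /andP[_ hd].
  case: (eqVneq (branch_size p d) j) => [dj|_]; last by rewrite andbF.
  suff : j <= K by lia.
  apply: Kmax; apply/hasP; exists d; last by rewrite dj.
  by rewrite mem_iota; move: hd; rewrite mem_index_iota.
rewrite /nbranches (size_parent_seqs hp) (bigD1_seq b) ?iota_uniq //=.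
  by rewrite bK eqxx leq_addr.
by move: hb; rewrite mem_iota mem_index_iota.
Qed.
(** * Betweenness in a recursive tree *)

Lemma mem_vertices_rec_tree m p v : p \in parent_seqs m ->
  (v \in vertices (rec_tree p)) = (1 <= v <= m.+1).
Proof.
elim: m p => [|m IH] p; first by rewrite inE => /eqP ->; rewrite inE; lia.
case/parent_seqsS => i [p' [-> _ hp]].
by rewrite !inE (IH p' hp) (size_parent_seqs hp); lia.
Qed.

Lemma perm_vertices_rec_tree m p : p \in parent_seqs m ->
  perm_eq (vertices (rec_tree p)) (iota 1 m.+1).
Proof.
move=> hp; apply: uniq_perm; rewrite ?fset_uniq ?iota_uniq // => v.
by rewrite (mem_vertices_rec_tree _ hp) mem_iota.
Qed.

Lemma adjC G u v : adj G u v = adj G v u.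
Proof. by rewrite /adj fsetUC. Qed.

Lemma adj_attach G i w u v :
  adj (attach G i w) u v =
  [|| (u == i) && (v == w), (u == w) && (v == i) | adj G u v].
Proof.
rewrite /adj /= in_fset1U orbA; congr orb; apply/eqP/orP => [e|[]].
- have := congr1 (fun A => u \in A) e; have := congr1 (fun A => v \in A) e.
  have := congr1 (fun A => i \in A) e; have := congr1 (fun A => w \in A) e.
  rewrite !inE !eqxx !orbT; lia.
- by case/andP => /eqP -> /eqP ->.
- by case/andP => /eqP -> /eqP ->; rewrite fsetUC.
Qed.

(** Edges away from the root stay inside one branch, so the root is the only passage between
    branches. *)
Lemma adj_rec_tree m p u v : p \in parent_seqs m -> adj (rec_tree p) u v ->
  [&& 1 <= u <= m.+1, 1 <= v <= m.+1
    & [|| u == 1, v == 1 | branch p u == branch p v]].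
Proof.
elim: m p => [|m IH] p; first by rewrite inE => /eqP ->.
case/parent_seqsS => i [p' [-> hi hp]].
rewrite [rec_tree _]/= adj_attach /= (size_parent_seqs hp).
case/or3P => [/andP[/eqP -> /eqP ->]|/andP[/eqP -> /eqP ->]|/(IH _ hp)].
- by case: (eqVneq i m.+2) => [|_]; rewrite ?eqxx; case: (eqVneq i 1) => //=;
    lia.
- by case: (eqVneq i m.+2) => [|_]; rewrite ?eqxx; case: (eqVneq i 1) => //=;
    lia.
- by case: (eqVneq u m.+2) => [|_]; case: (eqVneq v m.+2) => [|_]; lia.
Qed.

Lemma connected_rec_tree m p s t : p \in parent_seqs m ->
  1 <= s <= m.+1 -> 1 <= t <= m.+1 ->
  exists2 q, path (adj (rec_tree p)) s q & last s q = t.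
Proof.
elim: m p s t => [|m IH] p s t; first by move=> _ hs ht; exists [::] => //=;
  lia.
case/parent_seqsS => i [p' [-> hi hp]] hs ht.
rewrite [rec_tree _]/= (size_parent_seqs hp).
have new : adj (attach (rec_tree p') i m.+2) i m.+2.
  by rewrite adj_attach !eqxx.
have old x y : 1 <= x <= m.+1 -> 1 <= y <= m.+1 ->
    exists2 q, path (adj (attach (rec_tree p') i m.+2)) x q & last x q = y.
  move=> hx hy; have [q hq qy] := IH p' x y hp hx hy; exists q => //.
  by apply: sub_path hq => a b; rewrite adj_attach => ->; rewrite !orbT.
case: (eqVneq s m.+2) => sn; case: (eqVneq t m.+2) => tn.
- by exists [::] => //=; lia.
- have [q hq qt] := old i t ltac:(lia) ltac:(lia).
  by exists (i :: q) => //=; rewrite hq sn adjC new.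
- have [q hq qi] := old s i ltac:(lia) ltac:(lia).
  by exists (rcons q m.+2); rewrite ?last_rcons // rcons_path hq qi.
- by apply: old; lia.
Qed.

(** Connectedness provides a walk, and shortening it a simple path, so [xget] does not fall back on
    its default. *)
Lemma tree_path_simple m p s t : p \in parent_seqs m ->
  1 <= s <= m.+1 -> 1 <= t <= m.+1 ->
  simple_path (rec_tree p) s t (tree_path (rec_tree p) s t).
Proof.
move=> hp hs ht; rewrite /tree_path; case: xgetP => [q _ //|no].
have [q hq qt] := connected_rec_tree hp hs ht.
case/shortenP: hq qt => q' hq' uq' _ qt.
by case: (no q').
Qed.

Lemma leave_branch m p v q : p \in parent_seqs m -> v != 1 ->
  path (adj (rec_tree p)) v q -> branch p (last v q) != branch p v -> 1 \in q.
Proof.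
move=> hp; elim: q v => [|x q IH] v v1 /=; first by rewrite eqxx.
case/andP => vx xq; rewrite inE [1 == x]eq_sym;
  case: (eqVneq x 1) => [//|x1] /=.
have /and3P[_ _] := adj_rec_tree hp vx.
by rewrite (negbTE v1) (negbTE x1) => /eqP ->; apply: IH.
Qed.

Lemma root_in_path_interior m p s t : p \in parent_seqs m ->
  1 < s <= m.+1 -> 1 < t <= m.+1 -> branch p s != branch p t ->
  1 \in path_interior (rec_tree p) s t.
Proof.
move=> hp hs ht hst; rewrite /path_interior.
have [] := tree_path_simple (s := s) (t := t) hp ltac:(lia) ltac:(lia).
move: (tree_path _ _ _) => q hq _ qt.
have : 1 \in q.
  by apply: (leave_branch hp _ hq); [lia | rewrite qt eq_sym].
case: q qt {hq} => [//|x q] /= qt.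
rewrite lastI mem_rcons inE qt => /orP[/eqP|//]; lia.
Qed.

(** Counterpart of [leave_branch]: the root is met before the final [v], possibly already at [s]. *)
Lemma enter_branch m p s q v : p \in parent_seqs m -> v != 1 ->
  path (adj (rec_tree p)) s (rcons q v) -> branch p s != branch p v ->
  1 \in s :: q.
Proof.
move=> hp v1; elim: q s => [|x q IH] s /=; rewrite ?andbT.
  move=> /(adj_rec_tree hp) /and3P[_ _]; rewrite inE (negbTE v1) /=; lia.
case/andP => sx xq sv; case: (eqVneq (branch p x) (branch p v)) => [e|xv].
  have /and3P[_ _] := adj_rec_tree hp sx; rewrite e (negbTE sv) orbF !inE.
  by case/orP => /eqP ->; rewrite eqxx ?orbT.
by rewrite inE IH ?orbT.
Qed.

(** A path through [v] would meet the root once before [v] and once after it, contradicting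
    simplicity. *)
Lemma notin_path_interior m p s t v : p \in parent_seqs m -> v != 1 ->
  1 <= s <= m.+1 -> 1 <= t <= m.+1 ->
  branch p s != branch p v -> branch p t != branch p v ->
  v \notin path_interior (rec_tree p) s t.
Proof.
move=> hp v1 hs ht sv tv; rewrite /path_interior; apply/negP.
have [] := tree_path_simple hp hs ht.
move: (tree_path _ _ _) => q hq uq qt vq.
have vq' : v \in q.
  case: q vq {hq uq qt} => [//|x q] /= vq.
  by rewrite lastI mem_rcons inE vq orbT.
case: (path.splitPr vq') hq uq qt {vq} => q1 q2 hq uq qt.
have in1 : 1 \in s :: q1.
  apply: (enter_branch (v := v) hp) => //.
  by move: hq; rewrite -cat_rcons cat_path => /andP[].
have in2 : 1 \in q2.
  move: hq; rewrite cat_path => /andP[_] /= /andP[_ hq].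
  by apply: (leave_branch hp v1 hq); move: qt; rewrite last_cat /= => ->.
move: uq; rewrite -cat_cons cat_uniq => /and3P[_ /hasPn /(_ 1)].
by rewrite inE in2 orbT in1 => /(_ isT).
Qed.

(** * Bounds on betweenness and the rank of the root *)

Lemma count_branch m p v : p \in parent_seqs m -> 1 < v <= m.+1 ->
  count (fun s => branch p s == branch p v) (iota 2 m) = branch_size p (branch
    p v).
Proof.
move=> hp hv; rewrite /branch_size (size_parent_seqs hp).
rewrite -[iota 1 _]/(1 :: iota 2 m) /= branch_root.
by have := branch_bounds hp hv; lia.
Qed.

(** The root separates [s] from every non-root vertex of another branch. With x the size of the
    branch of [v], there are m - x such vertices for each of the x vertices [s] in that branch, and
    at least m - L for each of the m - x others. *)
Lemma betweenness_root_ge m p v L : p \in parent_seqs m -> 1 < v <= m.+1 ->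
  (forall a, 1 < a <= m.+1 -> branch_size p a <= L) ->
  (m - branch_size p (branch p v)) * (m + branch_size p (branch p v) - L)
  <= betweenness (rec_tree p) 1.
Proof.
move=> hp hv hL; set x := branch_size _ _; rewrite /betweenness.
under eq_bigr do rewrite (perm_big _ (perm_vertices_rec_tree hp)) /=.
rewrite (perm_big _ (perm_vertices_rec_tree hp)) /=.
have red (F : nat -> nat) :
  \sum_(s <- iota 1 m.+1 | s != 1) F s = \sum_(s <- iota 2 m) F s.
  rewrite -[iota 1 _]/(1 :: iota 2 m) big_cons /= big_seq_cond [RHS]big_seq.
  by apply: eq_bigl => s; rewrite mem_iota; lia.
rewrite red; under eq_bigr do rewrite red.
have xm : x <= m by rewrite -[leqRHS](size_iota 2 m) /x -(count_branch hp hv)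
  count_size.
have xL : x <= L by have := branch_bounds hp hv => ?; apply: hL; lia.
have ctot : x + count (fun s => branch p s != branch p v) (iota 2 m) = m.
  by rewrite /x -(count_branch hp hv) count_predC size_iota.
apply: (@leq_trans (\sum_(s <- iota 2 m)
    ((branch p s == branch p v) * (m - x) + (branch p s != branch p v) * (m -
      L)))).
  rewrite big_split /= -!big_distrl /= !sum_nat_indicator (count_branch hp hv)
    -/x.
  rewrite (_ : count _ _ = m - x); last by rewrite -[m in RHS]ctot addKn.
  by rewrite [x * _]mulnC -mulnDr leq_mul2l; lia.
rewrite big_seq [leqRHS]big_seq; apply: leq_sum => s; rewrite mem_iota => hs.
apply: (@leq_trans (m - branch_size p (branch p s))).
  case: (eqVneq (branch p s) (branch p v)) => [->|_] /=; first lia.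
  have := branch_bounds (x := s) hp ltac:(lia) => hb.
  have := hL (branch p s) ltac:(lia); lia.
rewrite -(count_branch (v := s) hp) ; last lia.
rewrite -[X in X - _](size_iota 2 m) -(count_predC (fun t => branch p t ==
  branch p s)).
rewrite addKn -sum_nat_indicator big_seq [leqRHS]big_seq; apply: leq_sum => t.
rewrite mem_iota => ht /=; case: eqVneq => // st.
by rewrite (root_in_path_interior hp) ?[branch p s == _]eq_sym //; lia.
Qed.

(** Among the m^2 ordered pairs avoiding [v], those with both ends outside its branch contribute 0.
    The root is one of these possible ends, hence [m.+1]. *)
Lemma betweenness_le m p v : p \in parent_seqs m -> 1 < v <= m.+1 ->
  betweenness (rec_tree p) v + (m.+1 - branch_size p (branch p v)) ^ 2 <= m ^ 2.
Proof.
move=> hp hv; rewrite /betweenness.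
under eq_bigr do rewrite (perm_big _ (perm_vertices_rec_tree hp)) /=.
rewrite (perm_big _ (perm_vertices_rec_tree hp)) /=.
have out : m.+1 - branch_size p (branch p v) =
    \sum_(s <- iota 1 m.+1 | s != v) (branch p s != branch p v).
  rewrite /branch_size (size_parent_seqs hp) -[X in X - _](size_iota 1 m.+1).
  rewrite -(count_predC (fun t => branch p t == branch p v)) addKn
    -sum_nat_indicator.
  rewrite [RHS]big_mkcond; apply: eq_bigr => s _ /=.
  by case: (eqVneq s v) => [->|//]; rewrite eqxx.
have all1 : \sum_(s <- iota 1 m.+1 | s != v) 1 = m.
  rewrite sum1_count -[RHS]/(m.+1.-1) -[in RHS](size_iota 1 m.+1).
  rewrite -(count_predC (pred1 v)) count_uniq_mem ?iota_uniq // mem_iota.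
  by rewrite (_ : (_ && _) = true) //; lia.
rewrite out; set B := \sum_(s <- _ | _) _; set S := \sum_(s <- _ | _) _.
rewrite (_ : m ^ 2 = \sum_(s <- iota 1 m.+1 | s != v)
  \sum_(t <- iota 1 m.+1 | t != v) 1); last first.
  by rewrite all1 -[in LHS]mulnn -{1}all1 big_distrl; apply: eq_bigr => s _;
    rewrite /= mul1n.
rewrite -mulnn {1}/S big_distrl /= -big_split big_seq_cond [leqRHS]big_seq_cond
  /=.
apply: leq_sum => s /andP[]; rewrite mem_iota => hs sv.
rewrite {}/S big_distrr -big_split big_seq_cond [leqRHS]big_seq_cond /=.
apply: leq_sum => t /andP[]; rewrite mem_iota => ht tv.
case: (eqVneq (branch p s) (branch p v)) => sb; first by case: (v \in _).
case: (eqVneq (branch p t) (branch p v)) => tb; first by case: (v \in _).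
by rewrite (negbTE (notin_path_interior hp _ _ _ sb tb)) //; lia.
Qed.

Lemma index_sort_head (T : eqType) (le : rel T) (x : T) (s : seq T) :
  total le -> transitive le -> x \in s ->
  (forall y, y \in s -> y != x -> ~~ le y x) -> index x (sort le s) = 0.
Proof.
move=> tot tr xs first; have : x \in sort le s by rewrite mem_sort.
have := sort_sorted tot s; have : {subset sort le s <= s} by move=> y;
  rewrite mem_sort.
case: (sort le s) => [//|y t] sub /= srt; rewrite inE.
case: eqVneq => [-> //|xy] /= xt; have := order_path_min tr srt.
move=> /allP /(_ x xt) yx; have := first y (sub y (mem_head _ _)).
by rewrite eq_sym xy yx => /(_ isT).
Qed.

(** With m = x + y, the conclusion is m^2 - (y + 1)^2 < y (m + x - L) after cancellation. For fixed
    n and L, the right side minus the left is n^2 - n L + L - (2 n - L) x. It is smallest at x = L,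
    with value n^2 - 3 n L + L^2 + L > 0. *)
Lemma root_gap_pos (n x y L : nat) : n = x + y + 1 -> 0 < x <= L ->
  2 * L <= n -> 3 * n * L <= L ^ 2 + n ^ 2 -> x ^ 2 + y * L < (y + 1) ^ 2.
Proof.
move=> -> /andP[x0 /subnKC]; set d := L - x => <- h2 h3.
have gap : (x + d) * d <= 2 * (x + y + 1) * d by rewrite leq_mul2r; lia.
lia.
Qed.

Lemma betweenness_rank_root m p L : p \in parent_seqs m -> 2 * L <= m.+1 ->
  3 * m.+1 * L <= L ^ 2 + m.+1 ^ 2 ->
  (forall a, 1 < a <= m.+1 -> branch_size p a <= L) ->
  betweenness_rank (rec_tree p) 1 = 1.
Proof.
move=> hp hL2 hL hc; rewrite /betweenness_rank index_sort_head //.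
- by move=> u v; rewrite /ranked_before; lia.
- by move=> u v w; rewrite /ranked_before; lia.
- by rewrite (mem_vertices_rec_tree _ hp).
move=> v; rewrite (mem_vertices_rec_tree _ hp) => hv v1.
have hv' : 1 < v <= m.+1 by lia.
have := betweenness_root_ge hp hv' hc; have := betweenness_le hp hv'.
have := branch_bounds hp hv' => hb; have := hc (branch p v) ltac:(lia).
have : 0 < branch_size p (branch p v).
  rewrite -(count_branch hp hv') -has_count; apply/hasP; exists v => //.
  by rewrite mem_iota; lia.
rewrite /ranked_before; set x := branch_size _ _; set B1 := betweenness _ 1.
move=> x0 xL hB hB1; suff : betweenness (rec_tree p) v < B1 by lia.
apply: leq_trans hB1; have xm : x <= m by lia.
have := @root_gap_pos m.+1 x (m - x) L ltac:(lia) ltac:(lia) hL2 hL.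
move: hB; rewrite -(subnKC xm); set y := m - x.
move: (betweenness _ _) => B; rewrite addKn.
rewrite (_ : (x + y).+1 - x = y + 1); last lia.
(* Here 2 L <= m + 1 and x > 0 ensure that the subtraction of [L] is not truncated. *)
have [w hw] : exists w, x + y + x = w + L.
  by exists (x + y + x - L); lia.
rewrite hw addnK => hB gap.
have : y * (x + y + x) = y * (w + L) by rewrite hw.
lia.
Qed.

Local Open Scope classical_set_scope.
Local Open Scope ring_scope.

(** * Asymptotics *)

(** All m! parent sequences are equally likely: the induction splits the event by the parent of the
    last vertex, which is uniform and independent of the past. *)
Lemma urrt_law (R : realType) (d : measure_display) (Omega : measurableType d)
    (P : probability Omega R) (T : nat -> Omega -> graph) (m : nat)
    (A : set graph) : is_urrt P T ->
  P (T m.+1 @^-1` A) =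
  ((count (fun p => rec_tree p \in A) (parent_seqs m))%:R / m`!%:R)%:E.
Proof.
move=> [Tmeas [T1 [U hU]]]; elim: m A => [|m IH] A.
  rewrite divr1 /= addn0.
  have [Ar|nAr] := pselect (A root_graph).
    rewrite (_ : _ @^-1` _ = setT) ?probability_setT ?mem_set //.
    by apply/seteqP; split => // w _; rewrite /= T1.
  rewrite (_ : _ @^-1` _ = set0) ?measure0 ?memNset //.
  by apply/seteqP; split => // w; rewrite /= T1.
have [Umeas Ustep Uunif Uindep] := hU m.+1 isT.
pose B k := [set G | A (attach G k.+1 m.+2)].
pose F k := U m.+1 @^-1` [set k.+1] `&` T m.+1 @^-1` B k.
have -> : T m.+2 @^-1` A = \big[setU/set0]_(k < m.+1) F k.
  rewrite -bigcup_mkord; apply/seteqP; split => [w Aw|w [k /= km [Uk]]].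
    have [Ub Tw] := Ustep w; exists (U m.+1 w).-1 => /=; first lia.
    by split; rewrite /= /B /= prednK -?Tw //; lia.
  by rewrite /B /= (Ustep w).2 /= Uk.
have mF k : measurable (F k) by apply: measurableI;
  [apply: Umeas | apply: Tmeas].
have tF : trivIset setT F.
  apply/trivIsetP => i j _ _ ij; apply/seteqP;
    split => // w [] /= [Ui _] [Uj _].
  by move: ij; rewrite -eqSS -Ui -Uj eqxx.
rewrite measure_bigsetU //.
have PF k : (k < m.+1)%N -> P (F k) = ((m.+1%:R)^-1 *
    ((count (fun p => rec_tree p \in B k) (parent_seqs m))%:R / m`!%:R))%:E.
  (* Only the tree at time [m.+1] is constrained; [setT] at the earlier times makes the past event a
     condition on that tree alone. *)
  move=> km; have :=
    Uindep [set k.+1] (fun l => if l == m.+1 then B k else setT).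
  rewrite /= (_ : \bigcap_(_ in _) _ = T m.+1 @^-1` B k); last first.
    apply/seteqP; split => w; first by move=> /(_ m.+1); rewrite /= eqxx;
      apply; rewrite leqnn.
    by move=> Bw l _; case: eqP => // ->.
  by move=> ->; rewrite IH Uunif ?EFinM //; lia.
rewrite (eq_bigr (fun k : 'I_m.+1 => ((m.+1%:R)^-1 *
    ((count (fun p => rec_tree p \in B k) (parent_seqs m))%:R / m`!%:R))%:E));
  last by move=> k _; exact: (PF k (ltn_ord k)).
rewrite sumEFin; congr EFin.
rewrite -mulr_sumr -mulr_suml mulrCA factS natrM invfM; congr (_ * _).
rewrite -natr_sum; congr (_%:R).
rewrite -sum_nat_indicator parent_seqs_rec big_allpairs_dep /=.
rewrite (_ : iota 1 m.+1 = index_iota 1 m.+2) // big_add1 big_mkord.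
apply: eq_bigr => k _; rewrite -sum_nat_indicator; apply: eq_big_seq => p hp.
by rewrite /= (size_parent_seqs hp).
Qed.

(** This is [has_large_branch_le] averaged over all trees. The range of [j] keeps k + j <= m, where
    the mean number of pairs is exactly 1/(k j). *)
Lemma large_branch_freq_le (R : realType) (m L : nat) : (m <= 3 * L.+1)%N ->
  (count (fun p => has (fun a => L < branch_size p a)%N (iota 2 m))
     (parent_seqs m))%:R / m`!%:R <=
  \sum_(L.+1 <= k < m.+1) k%:R^-1 * (1 - \sum_(k.+1 <= j < (m - k).+1) j%:R^-1)
  :> R.
Proof.
move=> hL; set c := count _ _.
have mf : (m`!%:R : R) != 0 by rewrite pnatr_eq0 -lt0n fact_gt0.
have mf0 : (0 : R) < m`!%:R by rewrite ltr0n fact_gt0.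
have nat_le : (c + \sum_(L.+1 <= k < m.+1) \sum_(k.+1 <= j < (m - k).+1)
     \sum_(p <- parent_seqs m) nbranch_pairs p k j <=
   \sum_(L.+1 <= k < m.+1) \sum_(p <- parent_seqs m) nbranches p k)%N.
  rewrite /c -sum_nat_indicator.
  under [X in (_ + X)%N]eq_bigr do rewrite exchange_big.
  rewrite exchange_big [leqRHS]exchange_big /= -big_split /=.
  rewrite big_seq [leqRHS]big_seq; apply: leq_sum => p hp.
  exact: has_large_branch_le.
rewrite ler_pdivrMr // mulr_suml.
move: nat_le; rewrite -(ler_nat R) natrD -lerBrDr !natr_sum -sumrB.
move=> /le_trans; apply; rewrite le_eqVlt; apply/orP; left; apply/eqP.
apply: eq_big_nat => k hk.
have k0 : (k%:R : R) != 0 by rewrite pnatr_eq0; lia.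
rewrite mulrBr mulr1 mulrBl; congr (_ - _).
  rewrite -(@sum_nbranches m k) ?natrM; first by rewrite mulKf.
  lia.
rewrite natr_sum -mulrA mulr_suml mulr_sumr; apply: eq_big_nat => j hj.
have j0 : (j%:R : R) != 0 by rewrite pnatr_eq0; lia.
rewrite -(@sum_nbranch_pairs m k j) ?natrM; [|lia|lia|lia].
by rewrite [k%:R * _]mulrC -[_ * k%:R * _]mulrA mulKf // mulKf.
Qed.

(** The inner sum has m - 2 k terms, each at least 1/(m - k), so the parenthesis is at most k/(m -
    k). *)
Lemma max_branch_term_le (R : realType) (m k : nat) :
  (0 < k)%N -> (2 * k <= m)%N ->
  k%:R^-1 * (1 - \sum_(k.+1 <= j < (m - k).+1) j%:R^-1) <= 2 / m%:R :> R.
Proof.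
move=> k0 km.
have kR : (0 : R) < k%:R by rewrite ltr0n.
have mkR : (0 : R) < (m - k)%:R by rewrite ltr0n; lia.
have mR : (0 : R) < m%:R by rewrite ltr0n; lia.
have S_ge : (m - k - k)%:R / (m - k)%:R <=
    \sum_(k.+1 <= j < (m - k).+1) j%:R^-1 :> R.
  rewrite mulrC mulr_natr -[X in _ *+ (X - k)]subSS -subSS subSS.
  rewrite (_ : (m - k - k)%N = ((m - k).+1 - k.+1)%N); last lia.
  rewrite -sumr_const_nat; apply: ler_sum_nat => j hj.
  by rewrite lef_pV2 ?posrE ?ler_nat ?ltr0n; lia.
apply: (@le_trans _ _ ((m - k)%:R^-1)).
  rewrite mulrC ler_pdivrMr //.
  have -> : (m - k)%:R^-1 * k%:R = 1 - (m - k - k)%:R / (m - k)%:R :> R.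
    rewrite (natrB _ (_ : (k <= m - k)%N)); last lia.
    by field; rewrite lt0r_neq0.
  by rewrite lerB.
rewrite -[leRHS]invrK lef_pV2 ?posrE ?invr_gt0 ?divr_gt0 // invf_div.
by rewrite ler_pdivrMr // -natrM ler_nat; lia.
Qed.

(** Each increment satisfies 1/(m + 1) <= - ln (1 - 1/(m + 1)). *)
Lemma sum_inv_le_ln (R : realType) (h m : nat) : (0 < h <= m)%N ->
  \sum_(h.+1 <= k < m.+1) k%:R^-1 <= ln (m%:R / h%:R) :> R.
Proof.
case/andP=> h0; elim: m => [|m IH]; first by lia.
have hR : (0 : R) < h%:R by rewrite ltr0n.
rewrite leq_eqVlt => /predU1P[<-|hm].
  by rewrite big_geq // divff ?ln1 // lt0r_neq0.
have mR : (0 : R) < m%:R by rewrite ltr0n; lia.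
have m1R : (0 : R) < m.+1%:R by rewrite ltr0n.
rewrite big_nat_recr //=.
have -> : ln (m.+1%:R / h%:R) = ln (m%:R / h%:R) - ln (1 + - (m.+1%:R)^-1) :> R.
  rewrite -ln_div ?posrE ?divr_gt0 //; last first.
    by rewrite subr_gt0 invf_lt1 // ltr1n; lia.
  by congr (ln _); rewrite -natr1; field; rewrite addrK natr1 !lt0r_neq0.
rewrite lerD ?IH // lerNr; apply: le_ln1Dx.
by rewrite ltrN2 invf_lt1 // ltr1n; lia.
Qed.

(** The sum is split at floor(m/2). Of the error 3/(m - 1), two parts come from rounding [L] and one
    from the parity of [m]. *)
Lemma large_branch_sum_le (R : realType) (c : R) (m L : nat) :
  (1 < m)%N -> (L <= m./2)%N -> 0 <= c -> c * m.+1%:R <= L.+1%:R ->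
  \sum_(L.+1 <= k < m.+1) k%:R^-1 * (1 - \sum_(k.+1 <= j < (m - k).+1) j%:R^-1)
  <= ln 2 + 1 - 2 * c + 3 / m.-1%:R.
Proof.
move=> m1; set h := m./2 => Lh c0 hL.
have mR : (0 : R) < m%:R by rewrite ltr0n; lia.
have m1R : (0 : R) < m.-1%:R by rewrite ltr0n; lia.
have h0 : (0 < h)%N by rewrite /h; lia.
have hR : (0 : R) < h%:R by rewrite ltr0n.
have hm : (h <= m)%N by rewrite /h; lia.
rewrite (big_cat_nat (n := h.+1)) //=.
have small : \sum_(L.+1 <= k < h.+1)
    k%:R^-1 * (1 - \sum_(k.+1 <= j < (m - k).+1) j%:R^-1) <=
    1 - 2 * c + 2 / m.-1%:R :> R.
  apply: (@le_trans _ _ (\sum_(L.+1 <= k < h.+1) (2 / m%:R : R))).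
    by apply: ler_sum_nat => k hk; apply: max_branch_term_le; lia.
  rewrite sumr_const_nat subSS -(mulr_natr (2 / m%:R)) natrB //.
  have h2 : 2 * h%:R <= m%:R :> R by rewrite -natrM ler_nat; lia.
  have hLR : c * (m%:R + 1) <= L%:R + 1 by rewrite !natr1.
  apply: (@le_trans _ _ (1 - 2 * c + 2 / m%:R)).
    rewrite -lerBlDr -[X in _ - X]mulr1 -mulrBr mulrAC ler_pdivrMr //.
    nra.
  by rewrite lerD2l ler_pM2l // lef_pV2 ?posrE // ler_nat; lia.
have large : \sum_(h.+1 <= k < m.+1)
    k%:R^-1 * (1 - \sum_(k.+1 <= j < (m - k).+1) j%:R^-1) <=
    ln 2 + (m.-1%:R)^-1 :> R.
  apply: (@le_trans _ _ (\sum_(h.+1 <= k < m.+1) k%:R^-1)).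
    apply: ler_sum_nat => k hk; rewrite ler_piMr ?invr_ge0 // gerBl.
    by apply: sumr_ge0 => j _; rewrite invr_ge0.
  apply: (le_trans (sum_inv_le_ln _ _)); first lia.
  (* [e] is 0 for even [m] and 1/(m - 1) for odd [m]. *)
  set e := (m%:R - 2 * h%:R) / (2 * h%:R) : R.
  have e0 : 0 <= e by rewrite divr_ge0 ?mulr_ge0 // subr_ge0 -natrM ler_nat;
    lia.
  have -> : m%:R / h%:R = 2 * (1 + e) :> R.
    by rewrite /e; field; rewrite lt0r_neq0.
  rewrite lnM ?posrE ?ltr_pwDl // lerD2l; apply: (@le_trans _ _ e).
    by apply: le_ln1Dx; apply: lt_le_trans e0; rewrite oppr_lt0.
  rewrite /e -natrM -natrB; last lia.
  rewrite ler_pdivrMr ?ltr0n; last lia.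
  by rewrite mulrC ler_pdivlMr // -natrM ler_nat; nia.
apply: le_trans (lerD small large) _; rewrite le_eqVlt; apply/orP; left.
by apply/eqP; field; rewrite lt0r_neq0.
Qed.

Lemma root_top_freq_ge (R : realType) (m : nat) : (3 < m)%N ->
  3 - Num.sqrt 5 - ln 2 - 3 / m.-1%:R <=
  (count (fun p => rec_tree p \in [set G | betweenness_rank G 1 = 1%N])
     (parent_seqs m))%:R / m`!%:R :> R.
Proof.
move=> m3; pose c : R := (3 - Num.sqrt 5) / 2.
have s5 : Num.sqrt 5 ^+ 2 = 5 :> R by rewrite sqr_sqrtr.
have s5ge : 0 <= Num.sqrt 5 :> R by rewrite sqrtr_ge0.
(* The upper bound on [c] yields L <= floor(m/2), the splitting point; the lower bound yields m <= 3
   (L + 1), so that at most one branch exceeds a given large one. *)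
have c_lt : c < 2 / 5 by rewrite /c; nra.
have c_gt : 1 / 3 < c by rewrite /c; nra.
have c_root : c ^+ 2 = 3 * c - 1 by rewrite /c; nra.
pose n : R := m.+1%:R; have n0 : 0 < n by rewrite ltr0n.
have cn0 : 0 <= c * n by apply: mulr_ge0; lra.
pose L := Num.truncn (c * n).
have /andP[Lle Lgt] : L%:R <= c * n < L.+1%:R := truncn_itv cn0.
have L5 : (5 * L <= 2 * m.+1)%N.
  by rewrite -(ler_nat R) !natrM -/n; nra.
have L3 : (m.+1 <= 3 * L.+1)%N.
  by rewrite -(ler_nat R) !natrM -/n; nra.
have L2 : (2 * L <= m.+1)%N by lia.
have Lh : (L <= m./2)%N by lia.
have mL : (m <= 3 * L.+1)%N by lia.
have c0 : 0 <= c by lra.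
have Lq : (3 * m.+1 * L <= L ^ 2 + m.+1 ^ 2)%N.
  rewrite -(ler_nat R) natrD !natrM -/n.
  (* Since [c] and [3 - c] are the roots of X^2 - 3 X + 1, the product equals L^2 - 3 n L + n^2. *)
  have : 0 <= (c * n - L%:R) * ((3 - c) * n - L%:R) by apply: mulr_ge0; nra.
  have : c ^+ 2 * n ^+ 2 = (3 * c - 1) * n ^+ 2 by rewrite c_root.
  nra.
pose bad p := has (fun a => L < branch_size p a)%N (iota 2 m).
have good p : p \in parent_seqs m -> ~~ bad p ->
    rec_tree p \in [set G | betweenness_rank G 1 = 1%N].
  move=> hp nbad; rewrite mem_set //=; apply: (betweenness_rank_root hp L2 Lq).
  move=> a ha; rewrite leqNgt; apply: contra nbad => La.
  by apply/hasP; exists a => //; rewrite mem_iota.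
have mf0 : (0 : R) < m`!%:R by rewrite ltr0n fact_gt0.
have cnt : (m`! - count bad (parent_seqs m) <=
    count (fun p => rec_tree p \in [set G | betweenness_rank G 1 = 1%N])
      (parent_seqs m))%N.
  rewrite -size_parent_seqs_fact -(count_predC bad) addKn.
  rewrite -!sum_nat_indicator big_seq [leqRHS]big_seq;
    apply: leq_sum => p hp /=.
  by case: (boolP (bad p)) => // /(good p hp) ->.
have := large_branch_freq_le R (m := m) (L := L) mL.
move/le_trans/(_ (large_branch_sum_le (ltn_trans _ m3) Lh c0 (ltW Lgt))).
move/(_ isT).
rewrite -/bad => hbad.
apply: (@le_trans _ _ (1 - (count bad (parent_seqs m))%:R / m`!%:R)).
  by rewrite /c in hbad; lra.
rewrite -[X in X - _](divff (lt0r_neq0 mf0)) -mulrBl ler_pM2r ?invr_gt0 //.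
by rewrite lerBlDr -natrD ler_nat addnC -leq_subLR.
Qed.

Theorem theorem18 (R : realType) (d : measure_display)
    (Omega : measurableType d) (P : probability Omega R)
    (T : nat -> Omega -> graph) (hT : is_urrt P T) :
  ((3 - Num.sqrt 5 - ln 2 : R)%:E <=
    limn_einf (fun n : nat => P [set w | betweenness_rank (T n w) 1%N = 1%N]))%E.
Proof.
rewrite limn_einf_lim; apply/lee_subgt0Pr => e e0.
apply: lime_ge; first exact: is_cvg_einfs.
have [K hK] : exists K : nat, 3 / e <= K%:R :> R.
  by exists (Num.truncn (3 / e)).+1; apply: ltW; apply: truncnS_gt.
(* With n = m + 1 >= K + 6, both m > 3 and m - 1 >= K hold, so the error 3/(m - 1) is at most
   [e]. *)
exists (K + 6)%N => // N /= hN.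
apply: le_ereal_inf_tmp => _ [n /= Nn <-].
case: n Nn => [|m] Nn; first lia.
rewrite (urrt_law m [set G | betweenness_rank G 1 = 1%N] hT) -EFinB lee_fin.
apply: le_trans (root_top_freq_ge R (m := m) _); last lia.
rewrite lerD2l lerN2 ler_pdivrMr ?ltr0n; last lia.
rewrite mulrC -ler_pdivrMr //; apply: (le_trans hK).
by rewrite ler_nat; lia.
Qed.
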